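(* Let $G$ be a finite group of order $n$. (a) If $G$ is not cyclic, then the distance spectrum of $\mathcal{P}_s(G)$ consists of the eigenvalue $n-1$ with multiplicity $1$ and the eigenvalue $-1$ with multiplicity $n-1$. (b) If $G\cong\mathbb{Z}_n$ for some composite number $n$, then the distance spectrum of $\mathcal{P}_s(\mathbb{Z}_n)$ consists of the eigenvalue $-1$ with multiplicity $n-3$ together with the three eigenvalues $$\frac{n-3+2\cos\frac{\theta}{3}\sqrt{n^2+9\phi(n)}}{3},\quad \frac{n-3+2\cos\frac{\theta+2\pi}{3}\sqrt{n^2+9\phi(n)}}{3},\quad \frac{n-3+2\cos\frac{\theta-2\pi}{3}\sqrt{n^2+9\phi(n)}}{3},$$ each with multiplicity $1$ (these four values being pairwise distinct), where $\theta=\arccos\frac{2n^3+27\phi(n)^2+27\phi(n)}{2\sqrt{(n^2+9\phi(n))^3}}$ and $0<\theta<\frac{\pi}{2}$.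
   Context: For a finite group $G$ of order $n$, the strong power graph $\mathcal{P}_s(G)$ is the simple graph with vertex set $G$ in which two distinct vertices $x,y$ are adjacent if and only if $x^{n_1}=y^{n_2}$ for some positive integers $n_1,n_2<n$. $\mathbb{Z}_n=\{0,1,\ldots,n-1\}$ is the cyclic group of order $n$ under addition modulo $n$. For a connected graph $\Gamma$, the distance matrix $D(\Gamma)$ has $(i,j)$ entry equal to the graph distance between the $i$-th and $j$-th vertices; the distance spectrum is the multiset of eigenvalues of $D(\Gamma)$ (roots of $\det(xI-D(\Gamma))$ with algebraic multiplicities). $\phi$ is Euler's totient function. *)

(* Defs.v *)
From HB Require Import structures.
From mathcomp Require Import all_boot all_order all_algebra all_fingroup all_solvable.
From mathcomp Require Import all_classical all_reals all_analysis.

Set Implicit Arguments.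
Unset Strict Implicit.
Unset Printing Implicit Defensive.

Import Order.TTheory GRing.Theory Num.Theory.
Local Open Scope ring_scope.

(* Finite simple graphs are symmetric irreflexive relations e : rel T on a
   finType T. *)

Definition connected_graph (T : finType) (e : rel T) : Prop :=
  forall x y : T, connect e x y.

Definition has_walk (T : finType) (e : rel T) (x y : T) (k : nat) : bool :=
  [exists p : k.-tuple T, path e x p && (last x p == y)].

(* Least length of a walk from x to y. A shortest walk is a path, hence has
   length < #|T|; the value is #|T| when y is not reachable from x. *)
Definition graph_dist (T : finType) (e : rel T) (x y : T) : nat :=
  find (has_walk e x y) (iota 0 #|T|).

Definition distance_matrix (R : nzRingType) (T : finType) (e : rel T) :
    'M[R]_#|T| :=
  \matrix_(i, j) (graph_dist e (enum_val i) (enum_val j))%:R.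

(* The multiset s, given as a list, is the multiset of roots of
   det(x I - D) with algebraic multiplicities. Connectedness is required
   because D is only defined for connected graphs. *)
Definition has_distance_spectrum (R : realType) (T : finType) (e : rel T)
    (s : seq R) : Prop :=
  connected_graph e /\
  char_poly (distance_matrix R e) = \prod_(a <- s) ('X - a%:P).

Definition strong_power_graph (gT : finGroupType) : rel gT :=
  fun x y => (x != y) &&
    [exists n1 : 'I_#|gT|, exists n2 : 'I_#|gT|,
      [&& (0 < n1)%N, (0 < n2)%N & (x ^+ n1 == y ^+ n2)%g]].

Arguments strong_power_graph gT : clear implicits.

Definition composite (n : nat) : bool := (1 < n)%N && ~~ prime n.

(* Main.v *)
Require Import Defs.
From HB Require Import structures.
From mathcomp Require Import all_boot all_order all_algebra all_fingroup all_solvable.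
From mathcomp Require Import all_classical all_reals all_analysis.
From mathcomp Require Import ring lra zify.

Set Implicit Arguments.
Unset Strict Implicit.
Unset Printing Implicit Defensive.

Import Order.TTheory GRing.Theory Num.Theory.
Local Open Scope ring_scope.

(** In a group of order [n], two elements of order smaller than [n] have the
    identity as a common power, and a generator has every element as a power.
    Hence the strong power graph is complete when [G] is not cyclic, and when
    [G] is cyclic of composite order the only non-adjacent pairs are the
    identity and a generator, at distance 2 through any other element.  So
    [D + I] is [J] in the first case and [J + e g^T + g e^T] in the second, where
    [e] and [g] are the indicator vectors of the identity and of the generators.
    These matrices have the form [U V] with 1 or 3 inner indices, and
    [y^k det (y - U V) = y^n det (y - V U)] reduces the spectrum to that of a
    1 x 1 or 3 x 3 matrix.  In the latter case the eigenvalues [mu] of [D + I]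
    solve [mu^3 - n mu^2 - 3 phi mu + phi (n - 1 - phi) = 0], which has three
    real roots given by Viete's trigonometric formula. *)

(** * Characteristic polynomials of low-rank products *)

(** Weinstein-Aronszajn identity, free of division so that it applies over a polynomial ring:
    clearing [V] in the block matrix [M] from the right gives [det (y - U V)], from the left
    [y^n det (y - V U)]. *)
Lemma det_scalar_sub_mulmx (R : comNzRingType) (n k : nat) (y : R)
    (U : 'M[R]_(n, k)) (V : 'M[R]_(k, n)) :
  y ^+ k * \det (y%:M - U *m V) = y ^+ n * \det (y%:M - V *m U).
Proof.
pose M := block_mx y%:M U V 1%:M.
have detM : \det M = \det (y%:M - U *m V).
  have : \det (M *m block_mx 1%:M 0 (- V) 1%:M) = \det (y%:M - U *m V).
    rewrite mulmx_block !mulmx1 !mulmx0 !mulmxN !mul1mx !add0r subrr.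
    by rewrite det_ublock det1 mulr1.
  by rewrite det_mulmx det_lblock !det1 !mulr1.
have : \det (block_mx 1%:M 0 (- V) y%:M *m M) =
       y ^+ n * \det (y%:M - V *m U).
  rewrite mulmx_block !mulmx1 !mul0mx !mul1mx !mulNmx !addr0.
  rewrite mul_mx_scalar mul_scalar_mx addNr addrC.
  by rewrite det_ublock det_scalar.
by rewrite det_mulmx det_lblock det1 det_scalar mul1r detM.
Qed.

(** Since [X - (A - 1) = (X + 1) - A], the determinant identity is used with [y = X + 1]. *)
Lemma char_poly_mulmx_sub1 (R : comNzRingType) (n k : nat)
    (U : 'M[R]_(n, k)) (V : 'M[R]_(k, n)) :
  ('X + 1) ^+ k * char_poly (U *m V - 1%:M) =
  ('X + 1) ^+ n * char_poly (V *m U - 1%:M).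
Proof.
have shift m (A : 'M[R]_m) :
    char_poly (A - 1%:M) = \det (('X + 1)%:M - map_mx polyC A).
  rewrite /char_poly /char_poly_mx map_mxB map_scalar_mx /=.
  by rewrite opprB addrA raddfD.
by rewrite !shift !map_mxM det_scalar_sub_mulmx.
Qed.

(** Cancelling [(X + 1)^k] leaves [(X + 1)^(n - k)], which supplies the eigenvalue -1. *)
Lemma char_poly_mulmx_sub1_spectrum (R : idomainType) (n k : nat) (s : seq R)
    (U : 'M[R]_(n, k)) (V : 'M[R]_(k, n)) :
  (k <= n)%N ->
  char_poly (V *m U - 1%:M) = \prod_(a <- s) ('X - a%:P) ->
  char_poly (U *m V - 1%:M) =
    \prod_(a <- s ++ nseq (n - k) (-1)) ('X - a%:P).
Proof.
move=> le_kn sVU; have X1neq0 : ('X + 1 : {poly R}) ^+ k != 0.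
  by rewrite expf_neq0 // monic_neq0 // -[1]opprK -polyCN monicXsubC.
apply: (mulfI X1neq0); rewrite char_poly_mulmx_sub1 sVU big_cat /=.
rewrite big_nseq iter_mulr_1 polyCN opprK -{1}(subnKC le_kn) exprD.
by rewrite -mulrA; congr (_ * _); rewrite mulrC.
Qed.

(** * The 3 x 3 Gram matrix and its cubic *)

(** Indexing [f] by naturals lets the entries of an explicit matrix compute. *)
Lemma det_mx33 (R : comNzRingType) (M : 'M[R]_3) (f : nat -> nat -> R) :
  (forall i j : 'I_3, M i j = f i j) ->
  \det M = f 0 0 * (f 1 1 * f 2 2 - f 1 2 * f 2 1)
         - f 0 1 * (f 1 0 * f 2 2 - f 1 2 * f 2 0)
         + f 0 2 * (f 1 0 * f 2 1 - f 1 1 * f 2 0).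
Proof.
move=> Mf; have -> : M = \matrix_(i, j) f i j.
  by apply/matrixP=> i j; rewrite mxE Mf.
rewrite (expand_det_row _ ord0) !big_ord_recl big_ord0 /cofactor.
rewrite !(expand_det_row _ ord0) !big_ord_recl !big_ord0 /cofactor !det_mx11.
by rewrite !mxE /= /bump /=; ring.
Qed.

Lemma cos_triple (R : realType) (x : R) :
  cos (3 * x) = 4 * cos x ^+ 3 - 3 * cos x.
Proof.
have -> : 3 * x = x *+ 2 + x by ring.
rewrite cosD cos_mulr2n sin_mulr2n.
have s2 := sin2cos2 x.
have -> : (cos x * sin x) *+ 2 * sin x = 2 * cos x * sin x ^+ 2 by ring.
by rewrite s2; ring.
Qed.

(* The Gram matrix [V U] of the vectors [1, g, e] against [1, e, g], where
   [N = #|G|] and [phi] is the number of generators. *)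
Definition gram_entry (R : nzRingType) (N phi : R) (i j : nat) : R :=
  (nth [::] [:: [:: N; 1; phi]; [:: phi; 0; phi]; [:: 1; 1; 0]] i)`_j.

Definition gram_mx (R : nzRingType) (N phi : R) : 'M[R]_3 :=
  \matrix_(i, j) gram_entry N phi i j.

(** The cubic in [mu] is [det (mu - gram_mx N phi)]; three distinct roots exhaust a monic polynomial
    of degree 3. *)
Lemma char_poly3_sub1 (R : realType) (N phi : R) (s : seq R) :
  size s = 3 -> uniq s ->
  {in s, forall l, let mu := l + 1 in
    mu ^+ 3 - N * mu ^+ 2 - 3 * phi * mu + phi * (N - 1 - phi) = 0} ->
  char_poly (gram_mx N phi - 1%:M) =
  \prod_(a <- s) ('X - a%:P).
Proof.
move=> size_s uniq_s roots_s; set A := (X in char_poly X).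
rewrite [LHS](@all_roots_prod_XsubC R _ s).
- by rewrite (monicP (char_poly_monic A)) scale1r.
- by rewrite size_char_poly size_s.
- apply/allP=> l /roots_s /= l_root; rewrite rootE.
  rewrite /char_poly (det_mx33 (f := fun i j => 'X *+ (i == j) -
     (gram_entry N phi i j
       - (i == j)%:R)%:P)); last by move=> i j; rewrite !mxE.
  rewrite /gram_entry /= !hornerE; apply/eqP; rewrite -[RHS]l_root; ring.
- by rewrite uniq_rootsE.
Qed.

(** At [mu = (N + 2 c r) / 3], 27 times the cubic is [2 r^3 (4 c^3 - 3 c) - (2 N^3 + 27 phi^2 + 27
    phi)], and [4 c^3 - 3 c] is [cos (3 x)]. *)
Lemma cubic_trigonometric_root (R : realType) (N phi r x : R) :
  r ^+ 2 = N ^+ 2 + 9 * phi ->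
  2 * r ^+ 3 * cos (3 * x) = 2 * N ^+ 3 + 27 * phi ^+ 2 + 27 * phi ->
  let mu := (N - 3 + 2 * cos x * r) / 3 + 1 in
  mu ^+ 3 - N * mu ^+ 2 - 3 * phi * mu + phi * (N - 1 - phi) = 0.
Proof.
move=> r2; rewrite cos_triple => cos3 /=; set c := cos x in cos3 *.
have -> : (N - 3 + 2 * c * r) / 3 + 1 = (N + 2 * c * r) / 3 by field.
(* Eliminating [phi] makes the final goal a plain identity in [N], [r] and [c]. *)
have eqphi : phi = (r ^+ 2 - N ^+ 2) / 9 by rewrite r2; field.
apply: (mulfI (_ : 27 != 0 :> R)); first by rewrite pnatr_eq0.
rewrite mulr0; transitivity (2 * r ^+ 3 * (4 * c ^+ 3 - 3 * c)
  - (2 * N ^+ 3 + 27 * phi ^+ 2 + 27 * phi)); last by rewrite cos3 subrr.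
by rewrite eqphi; field.
Qed.

Lemma acos_lt_pihalf (R : realType) (x : R) : 0 < x <= 1 -> acos x < pi / 2.
Proof.
move=> /andP[x_gt0 x_le1].
have x_itv : x \in `[(-1), 1] by rewrite in_itv /= x_le1 andbT; lra.
have acos_itv : acos x \in `[0, pi].
  by rewrite in_itv /= acos_ge0 ?acos_lepi //; move: x_itv; rewrite in_itv.
rewrite -ltr_cos ?acosK ?cos_pihalf // in_itv /=.
by have := pi_gt0 R; lra.
Qed.

(* Both sides squared differ by
   [27 phi (4 N^3 d + 9 phi (N^2 + 3 d (N + phi + 1)) + 108 phi^2)] with
   [d = N - phi - 1]. *)
Lemma cubic_discriminant_gt0 (R : realFieldType) (N phi : R) :
  0 < phi -> phi + 1 < N ->
  (2 * N ^+ 3 + 27 * phi ^+ 2 + 27 * phi) ^+ 2 <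
  4 * (N ^+ 2 + 9 * phi) ^+ 3.
Proof.
move=> phi_gt0 phi_lt; rewrite -subr_gt0.
have [d d_gt0 dE] : exists2 d, 0 < d & N - phi - 1 = d.
  by exists (N - phi - 1) => //; lra.
have -> : 4 * (N ^+ 2 + 9 * phi) ^+ 3
    - (2 * N ^+ 3 + 27 * phi ^+ 2 + 27 * phi) ^+ 2 =
  27 * phi * (4 * N ^+ 3 * d
    + 9 * phi * (N ^+ 2 + 3 * d * (N + phi + 1)) + 108 * phi ^+ 2).
  by rewrite -dE; ring.
have N_gt0 : 0 < N by lra.
by rewrite !(mulr_gt0, addr_gt0, exprn_gt0).
Qed.

(** * Viete's formula: three distinct real eigenvalues *)

Section CubicSpectrum.
Variables (R : realType) (N phi : R).
Hypotheses (phi_gt0 : 0 < phi) (phi_lt : phi + 1 < N).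

Let r := Num.sqrt (N ^+ 2 + 9 * phi).
Let theta := acos ((2 * N ^+ 3 + 27 * phi ^+ 2 + 27 * phi)
  / (2 * Num.sqrt ((N ^+ 2 + 9 * phi) ^+ 3))).
Let l x := (N - 3 + 2 * cos x * r) / 3.
Let s := [:: l (theta / 3); l ((theta + 2 * pi) / 3); l ((theta - 2 * pi) / 3)].

Let N_gt0 : 0 < N. Proof. by apply: lt_trans phi_lt; rewrite addr_gt0. Qed.

Let co_phi_gt0 : 0 < N - 1 - phi.
Proof. by rewrite -addrA -opprD subr_gt0 addrC. Qed.

Let rad_gt0 : 0 < N ^+ 2 + 9 * phi.
Proof. by rewrite addr_gt0 ?exprn_gt0 ?mulr_gt0. Qed.

Let r_gt0 : 0 < r. Proof. by rewrite sqrtr_gt0. Qed.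

Let r_sqr : r ^+ 2 = N ^+ 2 + 9 * phi. Proof. by rewrite sqr_sqrtr ?ltW. Qed.

Let r_cube : Num.sqrt ((N ^+ 2 + 9 * phi) ^+ 3) = r ^+ 3.
Proof. by rewrite -r_sqr exprAC sqrtr_sqr ger0_norm ?exprn_ge0 ?ltW. Qed.

Let c := (2 * N ^+ 3 + 27 * phi ^+ 2 + 27 * phi) / (2 * r ^+ 3).

(** Strict bounds put [theta = acos c] strictly between 0 and [pi / 2]. Squaring reduces the upper
    one to the discriminant inequality. *)
Let c_bounds : 0 < c < 1.
Proof.
have num_gt0 : 0 < 2 * N ^+ 3 + 27 * phi ^+ 2 + 27 * phi.
  by rewrite !addr_gt0 ?mulr_gt0 ?exprn_gt0.
have den_gt0 : 0 < 2 * r ^+ 3 by rewrite mulr_gt0 ?exprn_gt0.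
rewrite divr_gt0 //= ltr_pdivrMr // mul1r.
rewrite -ltr_sqr ?nnegrE ?ltW // [ltRHS]exprMn -exprM mulnC exprM r_sqr.
have -> : 2 ^+ 2 = 4 :> R by ring.
exact: cubic_discriminant_gt0.
Qed.

Lemma theta_bounds : 0 < theta < pi / 2.
Proof.
have /andP[c_gt0 c_lt1] := c_bounds; rewrite /theta r_cube -/c.
by rewrite acos_gt0 ?acos_lt_pihalf //; apply/andP; split; lra.
Qed.

Lemma spectrum_roots : {in s, forall l0, let mu := l0 + 1 in
  mu ^+ 3 - N * mu ^+ 2 - 3 * phi * mu + phi * (N - 1 - phi) = 0}.
Proof.
have /andP[c_gt0 c_lt1] := c_bounds.
(* Tripling the three angles gives [theta] and [theta] shifted by a full turn either way, all with
   the same cosine. *)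
have root x : cos (3 * x) = cos theta -> let mu := l x + 1 in
    mu ^+ 3 - N * mu ^+ 2 - 3 * phi * mu + phi * (N - 1 - phi) = 0.
  move=> cos3; apply: cubic_trigonometric_root => //.
  rewrite cos3 /theta r_cube -/c acosK ?in_itv /=; last by apply/andP; split; lra.
  by rewrite mulrC divfK // mulf_neq0 ?expf_neq0 ?gt_eqF.
move=> l0; rewrite !inE => /or3P[] /eqP ->; apply: root.
- by congr cos; field.
- have -> : 3 * ((theta + 2 * pi) / 3) = theta + pi + pi :> R by field.
  by rewrite !cosDpi opprK.
- by rewrite -[LHS]opprK -!cosDpi; congr cos; field.
Qed.

Lemma spectrum_uniq : uniq (-1 :: s).
Proof.
have /andP[theta_gt0 theta_lt] := theta_bounds; have pi0 := pi_gt0 R.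
have mem_pi x : 0 <= x <= pi -> x \in `[0, pi] by rewrite in_itv.
have l_lt x y : 0 <= x -> x < y -> y <= pi -> l y < l x.
  move=> x0 xy ypi; rewrite ltr_pM2r ?invr_gt0 // ltrD2l ltr_pM2r //.
  by rewrite ltr_pM2l // ltr_cos ?mem_pi //; lra.
(* As cosine is even, the third angle may be taken as [(2 pi - theta) / 3]. Then [theta / 3 < (2 pi
   - theta) / 3 < (theta + 2 pi) / 3] in [[0, pi]], where cosine decreases. *)
have l13 : l ((theta - 2 * pi) / 3) < l (theta / 3).
  have -> : l ((theta - 2 * pi) / 3) = l ((2 * pi - theta) / 3).
    by rewrite /l -cosN -mulNr opprB.
  by apply: l_lt; lra.
have l32 : l ((theta + 2 * pi) / 3) < l ((theta - 2 * pi) / 3).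
  have -> : l ((theta - 2 * pi) / 3) = l ((2 * pi - theta) / 3).
    by rewrite /l -cosN -mulNr opprB.
  by apply: l_lt; lra.
(* The value -1 means [mu = 0], where the cubic equals [phi (N - 1 - phi) > 0]. *)
rewrite cons_uniq; apply/andP; split.
  apply/negP => /spectrum_roots /=; rewrite addNr !expr0n /= !mulr0 !subr0 add0r.
  by apply/eqP; rewrite mulf_neq0 ?gt_eqF.
rewrite /= !inE negb_or (gt_eqF l13) (gt_eqF (lt_trans l32 l13)) /=.
by rewrite (lt_eqF l32).
Qed.

Lemma spectrum_char_poly :
  char_poly (gram_mx N phi - 1%:M) =
  \prod_(a <- s) ('X - a%:P).
Proof.
apply: char_poly3_sub1 => //; last exact: spectrum_roots.
by have /andP[] := spectrum_uniq.
Qed.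

End CubicSpectrum.

(** * Graph distances 0, 1 and 2 *)

Lemma graph_dist_eq (T : finType) (e : rel T) (x y : T) (k : nat) :
  (k < #|T|)%N -> has_walk e x y k ->
  (forall j, (j < k)%N -> ~~ has_walk e x y j) -> graph_dist e x y = k.
Proof.
move=> lt_kT walk_k walk_min; rewrite /graph_dist.
rewrite -(subnKC lt_kT) addSnnS iotaD find_cat size_iota add0n /= walk_k addn0.
by case: hasP => // -[j]; rewrite mem_iota => /andP[_ /walk_min/negP].
Qed.

Lemma has_walk0 (T : finType) (e : rel T) (x y : T) :
  has_walk e x y 0 = (x == y).
Proof.
apply/existsP/eqP => [[p]|->]; last by exists [tuple]; rewrite /= eqxx.
by rewrite tuple0 /= => /eqP.
Qed.

Lemma has_walk1 (T : finType) (e : rel T) (x y : T) :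
  has_walk e x y 1 = e x y.
Proof.
apply/existsP/idP => [[p]|exy]; last by exists [tuple y]; rewrite /= exy eqxx.
by case/tupleP: p => z p; rewrite tuple0 /= andbT => /andP[exz /eqP <-].
Qed.

Lemma graph_dist_refl (T : finType) (e : rel T) (x : T) :
  graph_dist e x x = 0%N.
Proof. by apply: graph_dist_eq; rewrite ?has_walk0 //; apply/card_gt0P; exists x. Qed.

Lemma graph_dist1 (T : finType) (e : rel T) (x y : T) :
  x != y -> e x y -> graph_dist e x y = 1%N.
Proof.
move=> neq_xy exy; apply: graph_dist_eq; rewrite ?has_walk1 //.
- by apply/card_gt1P; exists x, y.
- by case=> // _; rewrite has_walk0.
Qed.

Lemma graph_dist2 (T : finType) (e : rel T) (x y z : T) :
  x != y -> ~~ e x y -> e x z -> e z y -> graph_dist e x y = 2%N.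
Proof.
move=> neq_xy nexy exz ezy; apply: graph_dist_eq.
(* The search for a length stops below [#|T|], so 2 must be smaller. The vertex [z] differs from [x]
   and [y], otherwise these would be adjacent. *)
- apply/card_gt2P; exists x, y, z; split=> //; split=> //.
    by apply: contraNneq nexy => ->.
  by apply: contraNneq nexy => <-.
- by apply/existsP; exists [tuple z; y]; rewrite /= exz ezy eqxx.
- by case=> [|[]] // _; rewrite ?has_walk0 ?has_walk1.
Qed.

(** * Distance matrices as low-rank products minus the identity *)

Lemma complete_distance_spectrum (R : realType) (T : finType) (e : rel T) :
  (0 < #|T|)%N -> (forall x y, x != y -> e x y) ->
  has_distance_spectrum e
    ((#|T|%:R - 1 : R) :: nseq (#|T| - 1)%N (-1)).
Proof.
move=> T_gt0 complete_e; split=> [x y|].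
  by have [->|/complete_e/connect1] := eqVneq x y; first exact: connect0.
have -> : distance_matrix R e = const_mx 1 *m (const_mx 1 : 'rV_#|T|) - 1%:M.
  apply/matrixP=> i j; rewrite !mxE big_ord1 !mxE mulr1.
  have [<-|neq_ij] := eqVneq i j; first by rewrite graph_dist_refl subrr.
  by rewrite graph_dist1 ?subr0 ?complete_e // (inj_eq enum_val_inj).
apply: (@char_poly_mulmx_sub1_spectrum R #|T| 1 [:: #|T|%:R - 1]) => //.
rewrite big_seq1 /char_poly det_mx11 !mxE.
under eq_bigr do rewrite !mxE mulr1.
by rewrite sumr_const card_ord.
Qed.

Section BipartitePerturbation.
Variables (R : realType) (T : finType) (e : rel T) (x0 : T) (S : {set T}).
Hypotheses (x0S : x0 \notin S)
  (distE : forall x y, graph_dist e x y =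
     ((x != y) + (x == x0) * (y \in S) + (x \in S) * (y == x0))%N).

(** [V] lists the two indicators in the opposite order, so that [U V] is [J + e g^T + g e^T]. *)
Let U := \matrix_(i < #|T|, k < 3)
  [:: 1; (enum_val i == x0)%:R; (enum_val i \in S)%:R : R]`_k.
Let V := \matrix_(k < 3, i < #|T|)
  [:: 1; (enum_val i \in S)%:R; (enum_val i == x0)%:R : R]`_k.

Lemma distance_matrix_factor : distance_matrix R e = U *m V - 1%:M.
Proof.
apply/matrixP=> i j; rewrite !mxE distE !big_ord_recl big_ord0 !mxE /=.
rewrite (inj_eq enum_val_inj) !natrD !natrM mulr1 addr0.
by case: (i == j); rewrite /= ?mulr1n ?mulr0n; ring.
Qed.

Lemma gram_factor : V *m U = gram_mx #|T|%:R #|S|%:R.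
Proof.
have sumE (F : T -> R) : \sum_(i < #|T|) F (enum_val i) = \sum_x F x.
  by rewrite -(big_enum_val (A := T)).
have sum1 : \sum_(x : T) 1 = #|T|%:R :> R by rewrite sumr_const.
have sumS : \sum_(x : T) (x \in S)%:R = #|S|%:R :> R.
  rewrite -natr_sum -sum1_card [in RHS]big_mkcond /=.
  by congr _%:R; apply: eq_bigr => x _; case: (x \in S).
have sumx0 : \sum_(x : T) (x == x0)%:R = 1 :> R.
  by rewrite (bigD1 x0) //= eqxx big1 ?addr0 // => x /negPf ->.
(* An indicator times itself sums to the size of its support; [e] and [g] have disjoint supports
   because [x0] is not in [S]. *)
have idem (b : bool) : b%:R * b%:R = b%:R :> R by case: b; rewrite ?mulr1 ?mulr0.
have disj x : (x \in S)%:R * (x == x0)%:R = 0 :> R.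
  by have [->|] := eqVneq x x0; rewrite ?(negPf x0S) ?mul0r ?mulr0.
apply/matrixP=> -[[|[|[|//]]] ?] -[[|[|[|//]]] ?]; rewrite !mxE /gram_entry /=;
  under eq_bigr do rewrite !mxE /= ?mulr1 ?mul1r ?idem ?disj 1?mulrC ?disj.
all: by rewrite ?big1_eq ?(sumE (fun=> 1)) ?(sumE (fun x => (x == x0)%:R))
  ?(sumE (fun x => (x \in S)%:R)).
Qed.

End BipartitePerturbation.

(** * Adjacency in the strong power graph *)

Lemma strong_power_graphC (gT : finGroupType) : symmetric (strong_power_graph gT).
Proof.
suff sub x y : strong_power_graph gT x y -> strong_power_graph gT y x.
  by move=> x y; apply/idP/idP; apply: sub.
rewrite /strong_power_graph eq_sym => /andP[-> /existsP[i /existsP[j]]].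
move=> /and3P[i0 j0 xy]; apply/existsP; exists j; apply/existsP; exists i.
by rewrite i0 j0 eq_sym.
Qed.

Lemma strong_power_graphP (gT : finGroupType) (x y : gT) (i j : nat) :
  x != y -> (0 < i < #|gT|)%N -> (0 < j < #|gT|)%N -> (x ^+ i = y ^+ j)%g ->
  strong_power_graph gT x y.
Proof.
move=> neq_xy /andP[i_gt0 lt_i] /andP[j_gt0 lt_j] xy.
rewrite /strong_power_graph neq_xy; apply/existsP; exists (Ordinal lt_i).
by apply/existsP; exists (Ordinal lt_j); rewrite i_gt0 j_gt0 xy eqxx.
Qed.

Lemma strong_power_graph_small_order (gT : finGroupType) (x y : gT) :
  x != y -> (#[x]%g < #|gT|)%N -> (#[y]%g < #|gT|)%N -> strong_power_graph gT x y.
Proof.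
move=> neq_xy ox oy; apply: (@strong_power_graphP gT x y #[x]%g #[y]%g) => //.
- by rewrite order_gt0.
- by rewrite order_gt0.
- by rewrite !expg_order.
Qed.

Lemma cycle_order_card (gT : finGroupType) (x : gT) :
  #[x]%g = #|gT| -> <[x]>%g = [set: gT].
Proof.
by move=> ox; apply/eqP; rewrite eqEcard finset.subsetT cardsT -ox leqnn.
Qed.

Lemma strong_power_graph_generator (gT : finGroupType) (x y : gT) :
  x != y -> #[x]%g = #|gT| -> y != 1%g -> strong_power_graph gT x y.
Proof.
move=> neq_xy ox y_neq1.
have /cyclePmin[i lt_i yE] : y \in <[x]>%g by rewrite cycle_order_card ?inE.
(* Here [i > 0] because [y] is not the identity, and the exponent 1 is admissible because the group
   has two distinct elements. *)
apply: (@strong_power_graphP gT x y i 1) => //; rewrite ?expg1 //.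
- by rewrite -ox lt_i lt0n andbT; apply: contraNneq y_neq1 => i0; rewrite yE i0.
- by apply/card_gt1P; exists y, 1%g.
Qed.

(** Adjacency would give [x^j = 1], so the group order would divide a smaller positive [j]. *)
Lemma strong_power_graph_1generator (gT : finGroupType) (x : gT) :
  #[x]%g = #|gT| -> ~~ strong_power_graph gT 1%g x.
Proof.
move=> ox; apply/negP=> /andP[_ /existsP[i /existsP[j /and3P[_ j_gt0]]]].
rewrite expg1n eq_sym -order_dvdn ox => /(dvdn_leq j_gt0).
by rewrite leqNgt ltn_ord.
Qed.

Lemma noncyclic_order_lt (gT : finGroupType) (x : gT) :
  ~~ cyclic [set: gT] -> (#[x]%g < #|gT|)%N.
Proof.
move=> ncyc; rewrite ltn_neqAle -cardsT subset_leq_card ?finset.subsetT // andbT.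
by apply: contra ncyc; rewrite cardsT => /eqP /cycle_order_card <-; exact: cycle_cyclic.
Qed.

(** * Cyclic groups of composite order *)

Section CyclicComposite.
Variable gT : finGroupType.
Hypotheses (gT_cyclic : cyclic [set: gT]) (gT_composite : composite #|gT|).

Let S := [set x : gT | #[x]%g == #|gT|].

Let one_notin_S : 1%g \notin S.
Proof.
by rewrite inE order1; case/andP: gT_composite; case: #|gT| => [|[]].
Qed.

Lemma card_generators : #|S| = totient #|gT|.
Proof.
have [a genE] := cyclicP gT_cyclic.
have oa : #[a]%g = #|gT| by rewrite orderE -genE cardsT.
rewrite -oa totient_gen; congr #|pred_of_set _|; apply/setP=> x.
rewrite !inE /generator -genE; apply/eqP/eqP => [/cycle_order_card //|genxE].
by rewrite orderE -genxE cardsT.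
Qed.

(** The witness is [a^p] for a generator [a] and the least prime divisor [p] of [n]: its order is
    [n / p], and it is trivial only if [n = p]. Being neither identity nor generator, it is adjacent
    to every other vertex. *)
Lemma exists_intermediate_order :
  exists2 z : gT, z != 1%g & (#[z]%g < #|gT|)%N.
Proof.
have [a genE] := cyclicP gT_cyclic.
have oa : #[a]%g = #|gT| by rewrite orderE -genE cardsT.
have /andP[n_gt1 n_nprime] := gT_composite.
have p_pr := pdiv_prime n_gt1; have p_dvd := pdiv_dvd #|gT|.
have oz : #[a ^+ pdiv #|gT|]%g = (#|gT| %/ pdiv #|gT|)%N.
  by rewrite orderXdiv oa.
exists (a ^+ pdiv #|gT|)%g; last by rewrite oz ltn_Pdiv ?prime_gt1 // ltnW.
rewrite -order_dvdn oa; apply: contra n_nprime => n_dvd.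
by rewrite (eqP (_ : #|gT| == pdiv #|gT|)) // eqn_dvd n_dvd.
Qed.

(** The identity and the intermediate element both lie outside [S]. *)
Lemma card_generators_lt : (#|S| + 1 < #|gT|)%N.
Proof.
have [z z_neq1 oz] := exists_intermediate_order.
have zS : z \notin S by rewrite inE neq_ltn oz.
have := subset_leq_card (finset.subsetT (z |: (1%g |: S))).
by rewrite !cardsU1 finset.in_setU1 (negPf z_neq1) (negPf zS) one_notin_S cardsT /=; lia.
Qed.

Lemma order_lt_card (x : gT) : x \notin S -> (#[x]%g < #|gT|)%N.
Proof.
by rewrite inE ltn_neqAle => ->; rewrite -cardsT subset_leq_card ?finset.subsetT.
Qed.

Lemma strong_power_graph_adjacent (x y : gT) :
  x != y -> ~~ ((x == 1%g) && (y \in S)) -> ~~ ((x \in S) && (y == 1%g)) ->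
  strong_power_graph gT x y.
Proof.
move=> neq_xy; have [xS|/order_lt_card ox] := boolP (x \in S).
  rewrite inE in xS; move=> _ /= ?.
  exact: strong_power_graph_generator (eqP xS) _.
have [yS|/order_lt_card oy] := boolP (y \in S); last first.
  by move=> *; exact: strong_power_graph_small_order.
rewrite inE in yS; rewrite andbT => x_neq1 _; rewrite strong_power_graphC.
by apply: strong_power_graph_generator (eqP yS) _; rewrite // eq_sym.
Qed.

Lemma one_generator_dist (x : gT) : x \in S ->
  graph_dist (strong_power_graph gT) 1%g x = 2%N /\
  graph_dist (strong_power_graph gT) x 1%g = 2%N.
Proof.
have [z z_neq1 oz] := exists_intermediate_order.
have zS : z \notin S by rewrite inE neq_ltn oz.
move=> xS; have x_neq1 : x != 1%g by apply: contraTneq xS => ->.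
have z1 : strong_power_graph gT z 1%g.
  by apply: strong_power_graph_adjacent; rewrite ?(negPf zS) ?(negPf z_neq1).
have xz : strong_power_graph gT x z.
  apply: strong_power_graph_adjacent; rewrite ?(negPf zS) ?andbF ?(negPf z_neq1) ?andbF //.
  by apply: contraTneq xS => ->.
have nx : ~~ strong_power_graph gT 1%g x.
  by apply: strong_power_graph_1generator; apply/eqP; rewrite inE in xS.
split; apply: (@graph_dist2 _ _ _ _ z) => //.
- by rewrite eq_sym.
- by rewrite strong_power_graphC.
- by rewrite strong_power_graphC.
- by rewrite strong_power_graphC.
Qed.

Lemma strong_power_graph_dist (x y : gT) :
  graph_dist (strong_power_graph gT) x y =
  ((x != y) + (x == 1%g) * (y \in S) + (x \in S) * (y == 1%g))%N.
Proof.
have [<-|neq_xy] := eqVneq x y.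
  rewrite graph_dist_refl; have [->|] := eqVneq x 1%g; last by rewrite muln0.
  by rewrite (negPf one_notin_S).
have [/andP[/eqP x1 yS]|nxy] := boolP ((x == 1%g) && (y \in S)).
  by rewrite x1 (one_generator_dist yS).1 yS eqxx (negPf one_notin_S).
have [/andP[xS /eqP y1]|nyx] := boolP ((x \in S) && (y == 1%g)).
  by rewrite y1 (one_generator_dist xS).2 xS eqxx (negPf one_notin_S) muln0.
rewrite graph_dist1 ?strong_power_graph_adjacent // !mulnb.
by rewrite (negPf nxy) (negPf nyx).
Qed.

Lemma strong_power_graph_connected : connected_graph (strong_power_graph gT).
Proof.
have [z z_neq1 oz] := exists_intermediate_order.
have zS : z \notin S by rewrite inE neq_ltn oz.
have zx x : connect (strong_power_graph gT) z x.
  have [<-|neq] := eqVneq z x; first exact: connect0.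
  apply/connect1/strong_power_graph_adjacent => //.
    by rewrite (negPf z_neq1).
  by rewrite (negPf zS).
move=> x y; apply: connect_trans (zx y).
by rewrite (sym_connect_sym (@strong_power_graphC gT)).
Qed.

(** Keeping [s] abstract lets one factorization serve both [gT] and ['Z_n]. *)
Lemma cyclic_composite_distance_spectrum (R : realType) (s : seq R) :
  char_poly (gram_mx #|gT|%:R (totient #|gT|)%:R - 1%:M) =
    \prod_(a <- s) ('X - a%:P) ->
  has_distance_spectrum (strong_power_graph gT) (s ++ nseq (#|gT| - 3) (-1)).
Proof.
move=> sE; split; first exact: strong_power_graph_connected.
rewrite (distance_matrix_factor R strong_power_graph_dist).
apply: char_poly_mulmx_sub1_spectrum; last first.
  by rewrite gram_factor // card_generators.
(* [3 <= n] follows from [phi + 1 < n] and [phi >= 1]. *)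
apply: leq_trans card_generators_lt; rewrite card_generators addn1 !ltnS.
by rewrite totient_gt0; case/andP: gT_composite => /ltnW.
Qed.

End CyclicComposite.

Theorem theorem2p3 (R : realType) (gT : finGroupType) (n : nat)
    (order_n : #|gT| = n) :
  (~~ cyclic [set: gT]%G ->
     has_distance_spectrum (strong_power_graph gT)
       ((n%:R - 1 : R) :: nseq (n - 1)%N (-1)))
  /\
  (composite n -> [set: gT]%G \isog Zp n ->
     let phi : R := (totient n)%:R in
     let r : R := Num.sqrt (n%:R ^+ 2 + 9 * phi) in
     let theta : R :=
       acos ((2 * n%:R ^+ 3 + 27 * phi ^+ 2 + 27 * phi)
             / (2 * Num.sqrt ((n%:R ^+ 2 + 9 * phi) ^+ 3))) in
     let l1 : R := (n%:R - 3 + 2 * cos (theta / 3) * r) / 3 in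
     let l2 : R := (n%:R - 3 + 2 * cos ((theta + 2 * pi) / 3) * r) / 3 in
     let l3 : R := (n%:R - 3 + 2 * cos ((theta - 2 * pi) / 3) * r) / 3 in
     [/\ 0 < theta < pi / 2,
         uniq [:: -1; l1; l2; l3],
         has_distance_spectrum (strong_power_graph gT)
           ([:: l1; l2; l3] ++ nseq (n - 3)%N (-1))
       & has_distance_spectrum (strong_power_graph 'Z_n)
           ([:: l1; l2; l3] ++ nseq (n - 3)%N (-1))]).
Proof.
subst n; split=> [ncyc|comp isoZ phi r theta l1 l2 l3].
  apply: complete_distance_spectrum => [|x y neq_xy].
    by apply/card_gt0P; exists 1%g.
  by apply: strong_power_graph_small_order; rewrite ?noncyclic_order_lt.
have n_gt1 : (1 < #|gT|)%N by case/andP: comp.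
(* ['Z_n] always has at least two elements; its cardinal is [n] because [n > 1]. *)
have cardZ : #|'Z_#|gT| | = #|gT| by rewrite card_ord Zp_cast.
have Zcyc : cyclic [set: 'Z_#|gT|] by rewrite Zp_cycle cycle_cyclic.
have Gcyc : cyclic [set: gT].
  by rewrite (isog_cyclic isoZ) /= /Zp n_gt1.
have phi_gt0 : 0 < phi by rewrite ltr0n totient_gt0 ltnW.
have phi_lt : phi + 1 < #|gT|%:R.
  have := card_generators_lt Gcyc comp; rewrite card_generators //.
  by rewrite -(ltr_nat R) natrD.
have sE := spectrum_char_poly phi_gt0 phi_lt.
split.
- exact: theta_bounds.
- exact: spectrum_uniq.
- exact: cyclic_composite_distance_spectrum.
- rewrite -[in (_ - 3)%N]cardZ; apply: cyclic_composite_distance_spectrum => //.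
    by rewrite cardZ.
  by rewrite cardZ.
Qed.
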